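(* Let $\alpha,\beta,\gamma>-1$ and $\sigma>0$. Let $P_0(x,y)=1$ and, for $n=1,2,\dots$, define $$P_n(x,y)=P_n^{(\gamma,\alpha)}(2x-1)+P_n^{(\gamma,\beta)}(2y-1)-\binom{n+\gamma}{n},$$ $$Q_n(x,y)=\frac{(\gamma+\alpha+2)_n}{(\alpha+1)_{n-1}}(1-x)P_{n-1}^{(\gamma+2,\alpha)}(2x-1)-\sigma^{-1}\frac{(\gamma+\beta+2)_n}{(\beta+1)_{n-1}}(1-y)P_{n-1}^{(\gamma+2,\beta)}(2y-1).$$ Then, for $n\ge1$, $P_n$ and $Q_n$ are two polynomials in $\mathcal H_n^2(w_{\alpha,\gamma},w_{\beta,\gamma})$ and $$\langle P_n,Q_n\rangle_{\alpha,\beta,\gamma}=\frac{(\beta-\alpha)(\gamma+1)_{n+1}}{(2n+\gamma+\alpha+1)(2n+\gamma+\beta+1)(n-1)!}.$$ In particular, the two polynomials are orthogonal to each other if $\beta=\alpha$. Furthermore, $$\langle P_n,P_n\rangle_{\alpha,\beta,\gamma}=h_n^{\alpha,\gamma}+\sigma h_n^{\beta,\gamma},$$ $$\langle Q_n,Q_n\rangle_{\alpha,\beta,\gamma}=\frac{(\gamma+1)_2\,[(\alpha+\gamma+2)_n]^2}{(\alpha+\gamma+2)_2\,[(\alpha+1)_{n-1}]^2}h_{n-1}^{\alpha,\gamma+2}+\sigma^{-1}\frac{(\gamma+1)_2\,[(\beta+\gamma+2)_n]^2}{(\beta+\gamma+2)_2\,[(\beta+1)_{n-1}]^2}h_{n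-1}^{\beta,\gamma+2}.$$
   Context: $P_n^{(a,b)}$ is the usual Jacobi polynomial on $[-1,1]$ (orthogonal for $(1-t)^a(1+t)^b$, $P_n^{(a,b)}(1)=\binom{n+a}{n}$). $(a)_n=a(a+1)\cdots(a+n-1)$, $(a)_0=1$. For $\alpha,\gamma>-1$: $w_{\alpha,\gamma}(x)=x^\alpha(1-x)^\gamma$ on $[0,1]$, $c_{\alpha,\gamma}=\left(\int_0^1w_{\alpha,\gamma}\right)^{-1}$, and $h_n^{\alpha,\gamma}=c_{\alpha,\gamma}\int_0^1\left[P_n^{(\gamma,\alpha)}(2x-1)\right]^2w_{\alpha,\gamma}(x)\,dx$. The inner product is $$\langle f,g\rangle_{\alpha,\beta,\gamma}=c_{\alpha,\gamma}\int_0^1f(x,1)g(x,1)w_{\alpha,\gamma}(x)\,dx+\sigma c_{\beta,\gamma}\int_0^1f(1,y)g(1,y)w_{\beta,\gamma}(y)\,dy,$$ on $\mathbb R[x,y]/I$, $I=\langle(1-x)(1-y)\rangle$. $\mathcal H_n^2(w_{\alpha,\gamma},w_{\beta,\gamma})$ is the space of classes modulo $I$ of polynomials of total degree at most $n$ that are orthogonal, with respect to $\langle\cdot,\cdot\rangle_{\alpha,\beta,\gamma}$, to all polynomials of total degree at most $n-1$. *)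

(* Defs.v *)
From HB Require Import structures.
From mathcomp Require Import all_boot all_order all_algebra.
(* The notations of mpoly are only compatible with those of mathcomp-analysis
   when it is loaded first. *)
From mathcomp Require Import mpoly.
From mathcomp Require Import all_classical all_reals all_analysis.

Set Implicit Arguments.
Unset Strict Implicit.
Unset Printing Implicit Defensive.

Import Order.TTheory GRing.Theory Num.Theory.

Local Open Scope classical_set_scope.
Local Open Scope ring_scope.
Local Open Scope quotient_scope.

Section Jacobi.
Variable R : realType.
Implicit Types (a b x : R) (n : nat).

(* Pochhammer symbol (a)_n *)
Definition poch a n : R := \prod_(i < n) (a + i%:R).

(* x (x - 1) ... (x - n + 1) / n! *)
Definition rbinom x n : R := (\prod_(i < n) (x - i%:R)) / n`!%:R.

Definition is_jacobi a b n (p : {poly R}) : Prop :=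
  [/\ size p = n.+1,
      forall q : {poly R}, (size q <= n)%N ->
        \int[lebesgue_measure]_(t in `[(-1 : R), 1])
          (p.[t] * q.[t] * ((1 - t) `^ a * (1 + t) `^ b)) = 0
    & p.[1] = rbinom (n%:R + a) n].

(* The polynomial P_n^(a,b), singled out by is_jacobi when a, b > -1. *)
Definition jacobi a b n : {poly R} :=
  xget (0 : {poly R}) [set p | is_jacobi a b n p].

Definition weight a b x : R := x `^ a * (1 - x) `^ b.

Definition wconst a b : R :=
  (\int[lebesgue_measure]_(x in `[(0 : R), 1]) weight a b x)^-1.

(* In h_n^(alpha, gamma) the upper indices of P_n are swapped, because the
   substitution t = 2 x - 1 turns 1 - t into 2 (1 - x) and 1 + t into 2 x. *)
Definition hnorm a b n : R :=
  wconst a b * \int[lebesgue_measure]_(x in `[(0 : R), 1])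
    ((jacobi b a n).[2 * x - 1] ^+ 2 * weight a b x).

End Jacobi.

Section Wedge.
Variable R : realType.
Implicit Types (p q f g : {mpoly R[2]}).

Definition bX : {mpoly R[2]} := 'X_ord0.
Definition bY : {mpoly R[2]} := 'X_ord_max.

(* The value f(x, y). *)
Definition beval f (x y : R) : R := f.@[tnth [tuple x; y]].

Lemma bevalD x y f g : beval (f + g) x y = beval f x y + beval g x y.
Proof. exact: mevalD. Qed.

Lemma bevalM x y f g : beval (f * g) x y = beval f x y * beval g x y.
Proof. exact: mevalM. Qed.

Lemma beval1 x y : beval 1 x y = 1.
Proof. exact: meval1. Qed.

Lemma bevalN x y f : beval (- f) x y = - beval f x y.
Proof. exact: mevalN. Qed.

Lemma bevalX x y : beval bX x y = x.
Proof. by rewrite /beval mevalXU. Qed.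

Lemma bevalY x y : beval bY x y = y.
Proof. by rewrite /beval mevalXU. Qed.

Definition wedge_eq : {mpoly R[2]} := (1 - bX) * (1 - bY).

(* The ideal generated by (1 - x) (1 - y). *)
Definition wedge_ideal : {pred {mpoly R[2]}} :=
  fun p => `[< exists q, p = q * wedge_eq >].

Lemma wedge_idealP p :
  reflect (exists q, p = q * wedge_eq) (p \in wedge_ideal).
Proof. exact: asboolP. Qed.

Lemma wedge_eqx1 x : beval wedge_eq x 1 = 0.
Proof. by rewrite bevalM 2!bevalD !bevalN beval1 bevalY subrr mulr0. Qed.

Lemma wedge_eq1y y : beval wedge_eq 1 y = 0.
Proof. by rewrite bevalM 2!bevalD !bevalN beval1 bevalX subrr mul0r. Qed.

Lemma wedge_ideal_closed : idealr_closed wedge_ideal.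
Proof.
split.
- by apply/wedge_idealP; exists 0; rewrite mul0r.
- apply/negP => /wedge_idealP[q /(congr1 (fun f => beval f 1 1))].
  by rewrite beval1 bevalM wedge_eqx1 mulr0 => /eqP; rewrite oner_eq0.
- move=> a _ _ /wedge_idealP[q ->] /wedge_idealP[r ->]; apply/wedge_idealP.
  by exists (a * q + r); rewrite mulrDl mulrA.
Qed.

HB.instance Definition _ :=
  isIdealr.Build {mpoly R[2]} wedge_ideal wedge_ideal_closed.

(* R[x, y] / I *)
Definition wedge_ring := {ideal_quot wedge_ideal}.

Definition wclass p : wedge_ring := \pi_(wedge_ring) p.

Variables (sigma alpha beta gamma : R).

Definition bip f g : R :=
  wconst alpha gamma * \int[lebesgue_measure]_(x in `[(0 : R), 1])
    (beval f x 1 * beval g x 1 * weight alpha gamma x)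
  + sigma * wconst beta gamma * \int[lebesgue_measure]_(y in `[(0 : R), 1])
    (beval f 1 y * beval g 1 y * weight beta gamma y).

(* The inner product on R[x, y] / I. It does not depend on the choice of
   representatives (wip_class). *)
Definition wip (u v : wedge_ring) : R := bip (repr u) (repr v).

Lemma repr_wclass p : exists q, repr (wclass p) = p + q * wedge_eq.
Proof.
have : p - repr (wclass p) \in wedge_ideal.
  by rewrite Quotient.idealrBE /wclass reprK.
move=> /wedge_idealP[q h]; exists (- q).
by rewrite mulNr -h opprB addrC subrK.
Qed.

Lemma wip_class f g : wip (wclass f) (wclass g) = bip f g.
Proof.
have [p hp] := repr_wclass f; have [q hq] := repr_wclass g.
have ex1 h r x : beval (h + r * wedge_eq) x 1 = beval h x 1.
  by rewrite bevalD bevalM wedge_eqx1 mulr0 addr0.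
have e1y h r y : beval (h + r * wedge_eq) 1 y = beval h 1 y.
  by rewrite bevalD bevalM wedge_eq1y mulr0 addr0.
rewrite /wip /bip hp hq; congr (_ * _ + _ * _);
  by apply: eq_Rintegral => x _; rewrite ?ex1 ?e1y.
Qed.

(* The space H_n^2(w_{alpha,gamma}, w_{beta,gamma}) with respect to wip;
   msize p is 1 + the total degree of p, and 0 if p = 0. *)
Definition Hspace (n : nat) : set wedge_ring :=
  [set u | (exists2 p : {mpoly R[2]}, (msize p <= n.+1)%N & u = wclass p) /\
           (forall q : {mpoly R[2]}, (msize q <= n)%N ->
              wip u (wclass q) = 0)].

(* p(2 x - 1) and p(2 y - 1) as elements of R[x, y]; horner_alg a p is p
   evaluated at a in an R-algebra. *)
Definition in_x (p : {poly R}) : {mpoly R[2]} := horner_alg (2%:R * bX - 1) p.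
Definition in_y (p : {poly R}) : {mpoly R[2]} := horner_alg (2%:R * bY - 1) p.

Definition Ppoly (n : nat) : {mpoly R[2]} :=
  if n is 0 then 1 else
  in_x (jacobi gamma alpha n) + in_y (jacobi gamma beta n)
  - (rbinom (n%:R + gamma) n)%:MP.

(* Only meant for n >= 1. *)
Definition Qpoly (n : nat) : {mpoly R[2]} :=
  (poch (gamma + alpha + 2) n / poch (alpha + 1) n.-1) *:
    ((1 - bX) * in_x (jacobi (gamma + 2) alpha n.-1))
  - (sigma^-1 * (poch (gamma + beta + 2) n / poch (beta + 1) n.-1)) *:
    ((1 - bY) * in_y (jacobi (gamma + 2) beta n.-1)).

End Wedge.

(* Main.v *)
From HB Require Import structures.
Require Import Defs.
From mathcomp Require Import all_boot all_order all_algebra.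
From mathcomp Require Import mpoly.
From mathcomp Require Import all_classical all_reals all_analysis.
From mathcomp Require Import measurable_realfun.
From mathcomp Require Import ring lra.

(** A class modulo (1 - x) (1 - y) is the same thing as its two restrictions,
to the sides y = 1 and x = 1 of the wedge, and the inner product is a sum of
one Beta integral for each side (bip_bmean). On y = 1 the summand of P_n in y
takes its endpoint value, the binomial coefficient that is subtracted, so P_n
restricts to P_n^(gamma,alpha)(2 x - 1); the summand of Q_n in y vanishes, so
Q_n restricts to a multiple of (1 - x) P_(n-1)^(gamma+2,alpha)(2 x - 1). The
other side is symmetric. All claims thus become statements about Jacobi
polynomials in one variable.

Normalized to total mass 1, the weight x^a (1 - x)^b has moments
(a + 1)_i / (a + b + 2)_i. The functional bmean is defined on polynomials by
these moments, and Rintegral_poly_jweight says that it computes the integral.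
What this needs from analysis is the quotient of the masses for the exponents
(a + 1, b) and (a, b), which integration by parts gives (jmass_exchange).

In the functional bmean, multiplication by 1 - x only shifts the exponent b.
With the expansion of a Jacobi polynomial in powers of x, its mean against any
power of 1 - x is a Chu-Vandermonde sum (bmean_sjacobi). It follows that the
mean of the n-th polynomial times any q of degree at most n depends on q only
through its coefficient of degree n (bmean_sjacobi_mul). This one formula gives
the orthogonality of P_n to lower degrees, the uniqueness that identifies the
explicit polynomial with the Jacobi polynomial characterized by integrals, and
the value of <P_n, Q_n>.

Finally, Q_n is orthogonal to q of degree less than n although its two
restrictions are not: the restriction to y = 1 pairs with q to
(gamma + 1) q(1, 1), whatever alpha is (bmean_qrestr_mul), because subtracting
q(1, 1) leaves a multiple of 1 - x, and (1 - x)^2 turns the exponent gamma into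
gamma + 2, for which the Jacobi factor is orthogonal to lower degrees. On x = 1 the
factor - 1 / sigma of Q_n meets the factor sigma of the inner product, so the
two sides cancel. *)

Set Implicit Arguments.
Unset Strict Implicit.
Unset Printing Implicit Defensive.

Import Order.TTheory GRing.Theory Num.Theory.
Import numFieldNormedType.Exports.

Local Open Scope classical_set_scope.
Local Open Scope ring_scope.

(** * Pochhammer symbols and the Chu-Vandermonde sum *)

Section Pochhammer.
Variable R : realType.
Implicit Types (a b c : R) (n : nat).

Lemma fact_neq0 n : n`!%:R != 0 :> R.
Proof. by rewrite pnatr_eq0 -lt0n fact_gt0. Qed.

Lemma sign_mul_self n : (-1) ^+ n * (-1) ^+ n = 1 :> R.
Proof. by rewrite -expr2 sqrr_sign. Qed.

Lemma poch0 a : poch a 0 = 1.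
Proof. by rewrite /poch big_ord0. Qed.

Lemma pochS a n : poch a n.+1 = poch a n * (a + n%:R).
Proof. by rewrite /poch big_ord_recr. Qed.

Lemma poch_recl a n : poch a n.+1 = a * poch (a + 1) n.
Proof.
rewrite /poch big_ord_recl addr0; congr (_ * _).
by apply: eq_bigr => i _; rewrite -addrA lift0 -natr1 [1 + _]addrC.
Qed.

Lemma poch_add a m n : poch a (m + n) = poch a m * poch (a + m%:R) n.
Proof.
elim: n => [|n IHn]; first by rewrite addn0 poch0 mulr1.
by rewrite addnS !pochS IHn natrD; ring.
Qed.

Lemma poch_gt0 a n : 0 < a -> 0 < poch a n.
Proof. by move=> a0; apply: prodr_gt0 => i _; rewrite ltr_wpDr. Qed.

Lemma poch_neq0 a n : 0 < a -> poch a n != 0.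
Proof. by move=> a0; rewrite gt_eqF// poch_gt0. Qed.

(** The factor of index n - j - 1 is zero. *)
Lemma poch_opp_nat n j : (j < n)%N -> poch (j.+1%:R - n%:R : R) n = 0.
Proof.
move=> jn; have kn : (n - j.+1 < n)%N by rewrite ltn_subrL (leq_ltn_trans _ jn).
apply/eqP; rewrite prodf_seq_eq0; apply/hasP.
exists (Ordinal kn); first by rewrite mem_index_enum.
by apply/eqP; rewrite /= natrB//; ring.
Qed.

Lemma poch_nat n : poch (1 : R) n = n`!%:R.
Proof.
elim: n => [|n IHn]; first by rewrite poch0.
by rewrite pochS IHn factS natrM [1 + _]addrC natr1 mulrC.
Qed.

(** The same product read backwards, with each factor negated. *)
Lemma poch_reflect a n : poch (- a - n%:R + 1) n = (-1) ^+ n * poch a n.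
Proof.
rewrite /poch -[in LHS](big_mkord xpredT (fun i => - a - n%:R + 1 + i%:R)).
rewrite big_nat_rev /= big_mkord -[n in (-1) ^+ n]card_ord -prodrN.
apply: eq_bigr => i _; rewrite add0n natrB// -natr1; ring.
Qed.

(** Pascal's rule: iterated differences of u are iterated differences of its first
difference. *)
Lemma sum_alternating_binS n (u : nat -> R) :
  \sum_(k < n.+2) (-1) ^+ k *+ 'C(n.+1, k) * u k =
  \sum_(k < n.+1) (-1) ^+ k *+ 'C(n, k) * (u k - u k.+1).
Proof.
under [RHS]eq_bigr do rewrite mulrBr.
rewrite sumrB big_ord_recl bin0.
under eq_bigr => i _.
  rewrite lift0 binS mulrnDr mulrDl exprS mulN1r.
  over.
rewrite big_split /= addrA; congr (_ + _).
  rewrite big_ord_recr /= bin_small// mulr0n mul0r addr0.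
  rewrite [RHS]big_ord_recl bin0; congr (_ + _).
  by apply: eq_bigr => i _; rewrite lift0 exprS mulN1r.
by rewrite -sumrN; apply: eq_bigr => i _; rewrite mulNrn mulNr.
Qed.

(** By induction on n, for all b and c: the step of Pascal's rule leaves the
sum for (b, c) minus b / c times the sum for (b + 1, c + 1), both of order n. *)
Lemma chu_vandermonde n b c : 0 < c ->
  \sum_(k < n.+1) (-1) ^+ k *+ 'C(n, k) * (poch b k / poch c k) =
  poch (c - b) n / poch c n.
Proof.
elim: n b c => [|n IHn] b c c0.
  by rewrite big_ord1 bin0 expr0 mul1r !poch0.
rewrite (sum_alternating_binS n (fun k => poch b k / poch c k)).
under eq_bigr do rewrite mulrBr !poch_recl.
rewrite sumrB IHn//.
under eq_bigr do rewrite -mulf_div mulrCA.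
rewrite -mulr_sumr IHn; last by rewrite ltr_wpDr.
rewrite (_ : c + 1 - (b + 1) = c - b); last by ring.
have cn : c + n%:R != 0 by rewrite gt_eqF// ltr_wpDr.
have pc := poch_neq0 n c0.
have pc1 : poch (c + 1) n != 0 by rewrite poch_neq0// ltr_wpDr.
have c1 : c != 0 by rewrite gt_eqF.
have e : c * poch (c + 1) n = poch c n * (c + n%:R) by rewrite -poch_recl pochS.
rewrite !pochS mulf_div e; field.
by rewrite cn pc.
Qed.

End Pochhammer.

(** * The moment functional of the Beta distribution *)

Section BetaMean.
Variable R : realType.
Implicit Types (a b : R) (n : nat) (p q : {poly R}).

(** The integral of p against the probability density proportional to
x^a (1 - x)^b on [0, 1], given by its moments. In this algebraic
form it is linear by construction, and its use involves no integrability. *)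
Definition bmean a b p : R :=
  \sum_(i < size p) p`_i * (poch (a + 1) i / poch (a + b + 2) i).

Lemma bmean_widen a b n p : (size p <= n)%N ->
  bmean a b p = \sum_(i < n) p`_i * (poch (a + 1) i / poch (a + b + 2) i).
Proof.
move=> pn; rewrite /bmean.
rewrite (big_ord_widen n (fun i => p`_i * (poch (a + 1) i / poch (a + b + 2) i)))//.
rewrite big_mkcond; apply: eq_bigr => i _; case: ltnP => // pi.
by rewrite nth_default// mul0r.
Qed.

Lemma bmean_is_linear a b : linear (bmean a b : {poly R} -> R^o).
Proof.
move=> c p q.
set n := maxn (size p) (size q).
have pn : (size p <= n)%N by rewrite leq_maxl.
have qn : (size q <= n)%N by rewrite leq_maxr.
rewrite (bmean_widen _ _ pn) (bmean_widen _ _ qn) (@bmean_widen _ _ n); last first.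
  by rewrite (leq_trans (size_polyD _ _))// geq_max qn (leq_trans (size_scale_leq _ _)).
rewrite scaler_sumr -big_split; apply: eq_bigr => i _ /=.
by rewrite coefD coefZ mulrDl /GRing.scale /= mulrA.
Qed.

HB.instance Definition _ a b := GRing.isLinear.Build R {poly R} R^o _ (bmean a b)
  (bmean_is_linear a b).

Lemma bmeanXn a b n : bmean a b 'X^n = poch (a + 1) n / poch (a + b + 2) n.
Proof.
rewrite /bmean size_polyXn big_ord_recr /= coefXn eqxx mul1r big1 ?add0r// => i _.
by rewrite coefXn ltn_eqF// mul0r.
Qed.

Lemma bmean1 a b : bmean a b 1 = 1.
Proof. by have := bmeanXn a b 0; rewrite expr0 !poch0 divr1. Qed.

(** The factor 1 - x raises the second exponent by one, and (b + 1) / (a + b + 2)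
is the quotient of the two normalizing constants. *)
Lemma bmean_mul_1subX a b p : -1 < a -> -1 < b ->
  bmean a b ((1 - 'X) * p) = (b + 1) / (a + b + 2) * bmean a (b + 1) p.
Proof.
move=> a1 b1; have ab : 0 < a + b + 2 by lra.
rewrite -[p]coefK poly_def mulr_sumr !linear_sum mulr_sumr /=.
apply: eq_bigr => i _; rewrite -scalerAr !linearZ /= mulrCA; congr (_ * _).
rewrite mulrBl mul1r -exprS linearB /= !bmeanXn [poch (a + b + 2) i.+1]poch_recl.
rewrite (_ : a + (b + 1) + 2 = a + b + 2 + 1); last by ring.
have e : (a + b + 2) * poch (a + b + 2 + 1) i =
  poch (a + b + 2) i * (a + b + 2 + i%:R) by rewrite -poch_recl pochS.
have n1 : poch (a + b + 2) i != 0 by exact: poch_neq0.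
have n2 : poch (a + b + 2 + 1) i != 0 by apply: poch_neq0; lra.
have n3 : a + b + 2 + i%:R != 0 by rewrite gt_eqF// ltr_wpDr.
have n4 : a + b + 2 != 0 by rewrite gt_eqF.
rewrite mulf_div e pochS; field.
by rewrite n1 n3.
Qed.

Lemma bmean_mul_1subXn a b n p : -1 < a -> -1 < b ->
  bmean a b ((1 - 'X) ^+ n * p) =
  poch (b + 1) n / poch (a + b + 2) n * bmean a (b + n%:R) p.
Proof.
move=> a1; elim: n b => [|n IHn] b b1.
  by rewrite expr0 mul1r !poch0 divr1 mul1r addr0.
rewrite exprS -mulrA bmean_mul_1subX// IHn; last by lra.
rewrite !poch_recl mulrA mulf_div -addrA -[b + _ + _]addrA nat1r.
by rewrite (_ : a + (b + 1) + 2 = a + b + 2 + 1)//; ring.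
Qed.

End BetaMean.

(** * Integrals of derivatives with endpoint singularities *)

Section ImproperFTC.
Variable R : realType.
Notation mu := (@lebesgue_measure R).

(** The integrand may be unbounded at the endpoints, as x^a is for a < 0: the
fundamental theorem of calculus applies on the intervals [u + e, v - e], and the
limit is monotone as f is nonnegative. *)
Lemma ge0_integral_oo_FTC (f F : R -> R) (u v l r : R) : u < v ->
  {in `]u, v[, forall x : R, is_derive x 1 F (f x)} ->
  {in `]u, v[, continuous f} ->
  {in `]u, v[, forall x, 0 <= f x} ->
  F (u + e) @[e --> 0^'+] --> l ->
  F (v - e) @[e --> 0^'+] --> r ->
  (\int[mu]_(x in `]u, v[) (f x)%:E = (r - l)%:E)%E.
Proof.
move=> uv dF cf f0 Fu Fv.
(* The shift by 3 keeps e n below half the length, so that S n is a proper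
   interval for every n. *)
pose e n : R := (v - u) * n.+3%:R^-1.
have vu : 0 < v - u by rewrite subr_gt0.
have e0 n : 0 < e n by rewrite mulr_gt0// invr_gt0.
have e2 n : e n < (v - u) / 2.
  by rewrite ltr_pM2l// ltf_pV2 ?posrE// ltr_nat.
have ecvg : e n @[n --> \oo] --> (0 : R).
  rewrite -(mulr0 (v - u)); apply: cvgM; first exact: cvg_cst.
  have := @cvg_harmonic R; rewrite -(cvg_shiftn 2) /=.
  by under eq_fun do rewrite addn2.
have eS n : e n.+1 <= e n by rewrite ler_pM2l// lef_pV2 ?posrE// ler_nat.
pose S n := `[u + e n, v - e n]%classic : set R.
have Suv n : S n `<=` `]u, v[.
  move=> x; rewrite /S /= !in_itv /= => /andP[ux xv]; apply/andP; split.
    by apply: lt_le_trans ux; rewrite ltrDl.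
  by apply: le_lt_trans xv _; rewrite gtrBl.
have US : \bigcup_n S n = `]u, v[%classic.
  rewrite eqEsubset; split; first by move=> x [n _]; exact: Suv.
  move=> x /=; rewrite in_itv /= => /andP[ux xv].
  have m0 : 0 < Num.min (x - u) (v - x) by rewrite lt_min !subr_gt0 ux.
  have [N _ /(_ N (leqnn N))] : \forall n \near \oo, e n < Num.min (x - u) (v - x).
    exact: (cvgr_lt 0 ecvg).
  rewrite lt_min => /andP[h1 h2]; exists N => //; rewrite /S /= in_itv /=.
  by apply/andP; split; lra.
have nS : nondecreasing_seq S.
  apply/nondecreasing_seqP => n; rewrite subsetEset => x; rewrite /S /= !in_itv /=.
  by move=> /andP[ux xv]; have eSn := eS n; apply/andP; split; lra.
have mS n : measurable (S n) by exact: measurable_itv.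
have cfS n : {within S n, continuous f}.
  by apply: continuous_in_subspaceT => x /set_mem /Suv /cf.
have int_S n : (\int[mu]_(x in S n) (f x)%:E = (F (v - e n) - F (u + e n))%:E)%E.
  rewrite /S; apply: continuous_FTC2.
  - by have := e2 n; lra.
  - exact: cfS.
  - have sub x : x \in `]u + e n, v - e n[ -> x \in `]u, v[.
      move=> xS; apply: (Suv n); rewrite /S /=.
      by move: x xS; exact: subset_itv_oo_cc.
    have in_uv x : S n x -> {for x, continuous F}.
      move=> /Suv /dF [dFx _].
      exact/differentiable_continuous/derivable1_diffP.
    split.
    + by move=> x /sub /dF [].
    + apply: cvg_at_right_filter; apply: in_uv; rewrite /S /= in_itv /=.
      by have := e2 n; rewrite lexx /=; lra.
    + apply: cvg_at_left_filter; apply: in_uv; rewrite /S /= in_itv /=.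
      by have := e2 n; rewrite lexx /=; lra.
  - move=> x xS; rewrite derive1E.
    have /dF[_ //] : x \in `]u, v[.
    by apply: (Suv n); rewrite /S /=; exact: subset_itv_oo_cc xS.
rewrite -US.
have h1 : (\int[mu]_(x in S n) (f x)%:E)%E @[n --> \oo] -->
    (\int[mu]_(x in \bigcup_n S n) (f x)%:E)%E.
  apply: ge0_nondecreasing_set_cvg_integral => //.
  - move=> n; apply/measurable_EFinP.
    exact: subspace_continuous_measurable_fun.
  - by move=> n x /Suv /f0; rewrite lee_fin.
have h2 : (\int[mu]_(x in S n) (f x)%:E)%E @[n --> \oo] --> (r - l)%:E.
  under eq_fun do rewrite int_S.
  apply: cvg_EFin; first by near=> n.
  apply: cvgB.
  - exact: (cvg_at_rightP _ _ _).1 Fv e (conj e0 ecvg).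
  - exact: (cvg_at_rightP _ _ _).1 Fu e (conj e0 ecvg).
exact: cvg_unique h1 h2.
Unshelve. all: by end_near. Qed.

End ImproperFTC.

Section PowerDerivatives.
Variable R : realType.

Lemma is_derive_powR_left (u c x : R) : u < x ->
  is_derive x 1 (fun y => (y - u) `^ c) (c * (x - u) `^ (c - 1)).
Proof.
move=> ux; have xu : 0 < x - u by rewrite subr_gt0.
have d1 : is_derive x (1 : R) (fun y : R => y - u) 1.
  apply: (is_derive_eq (is_deriveB (is_derive_id _ _) (is_derive_cst _ _ _))).
  by rewrite subr0.
have d2 := is_derive1_powR c xu.
have := @is_derive1_comp R (fun y => y `^ c) (fun y => y - u) x _ _ d2 d1.
by rewrite mulr1.
Qed.

Lemma is_derive_powR_right (v c x : R) : x < v ->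
  is_derive x 1 (fun y => (v - y) `^ c) (- (c * (v - x) `^ (c - 1))).
Proof.
move=> xv; have vx : 0 < v - x by rewrite subr_gt0.
have d1 : is_derive x (1 : R) (fun y : R => v - y) (-1).
  apply: (is_derive_eq (is_deriveB (is_derive_cst _ _ _) (is_derive_id _ _))).
  by rewrite sub0r.
have d2 := is_derive1_powR c vx.
have := @is_derive1_comp R (fun y => y `^ c) (fun y => v - y) x _ _ d2 d1.
by rewrite mulrN1.
Qed.

Lemma is_derive_continuous (f : R -> R) (x d : R) :
  is_derive x (1 : R) f d -> {for x, continuous f}.
Proof. by case=> df _; exact/differentiable_continuous/derivable1_diffP. Qed.

End PowerDerivatives.

Lemma integrableRZl (dT : measure_display) (T : measurableType dT) (R : realType)
    (mu : {measure set T -> \bar R}) (D : set T) (k : R) (f : T -> R) :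
  measurable D -> mu.-integrable D (EFin \o f) ->
  mu.-integrable D (EFin \o (fun x => k * f x)).
Proof. by move=> mD; exact: integrableZl. Qed.

(** * Mass of the Jacobi weight *)

Section JacobiWeight.
Variables (R : realType) (u v : R).
Hypothesis uv : u < v.
Notation mu := (@lebesgue_measure R).
Implicit Types (a b c x : R).

(** The Jacobi weight on an arbitrary interval [u, v]. Working on [u, v] treats
[0, 1] and [-1, 1] at once, without a change of variables in an integral. *)
Definition jweight a b x := (x - u) `^ a * (v - x) `^ b.

Definition jmass a b : R := \int[mu]_(x in `]u, v[) jweight a b x.

Lemma measurable_jweight (D : set R) a b : measurable_fun D (jweight a b).
Proof.
apply: (measurable_funS measurableT) => //.
by apply: measurable_funM;
  apply: (measurableT_comp (measurable_powR _)); apply: measurable_funB.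
Qed.

Let d := v - u.
Let d0 : 0 < d. Proof. by rewrite subr_gt0. Qed.

Let powR_near c : (d - e) `^ c @[e --> 0^'+] --> d `^ c.
Proof.
apply: cvg_at_right_filter; rewrite -[X in _ --> X `^ _]subr0.
exact: is_derive_continuous (is_derive_powR_right c d0).
Qed.

Let powR_near0 c : 0 < c -> e `^ c @[e --> 0^'+] --> (0 : R).
Proof. exact: powR_cvg0. Qed.

(** A nonnegative function with an explicit primitive, of which suitable multiples
dominate the weight: it provides the integrable majorants below. *)
Let endpoint_sum a b x := (a + 1) * (x - u) `^ a + (b + 1) * (v - x) `^ b.
Let endpoint_diff a b x := (x - u) `^ (a + 1) - (v - x) `^ (b + 1).

Let is_derive_endpoint_diff a b :
  {in `]u, v[, forall x, is_derive x (1 : R) (endpoint_diff a b) (endpoint_sum a b x)}.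
Proof.
move=> x; rewrite in_itv /= => /andP[ux xv].
apply: (is_derive_eq (is_deriveB (is_derive_powR_left (a + 1) ux)
  (is_derive_powR_right (b + 1) xv))).
by rewrite opprK !addrK.
Qed.

Let continuous_endpoint_sum a b : {in `]u, v[, continuous (endpoint_sum a b)}.
Proof.
move=> x; rewrite in_itv /= => /andP[ux xv].
apply: cvgD; apply: cvgM; try exact: cvg_cst.
  exact: is_derive_continuous (is_derive_powR_left a ux).
exact: is_derive_continuous (is_derive_powR_right b xv).
Qed.

Let endpoint_sum_ge0 a b : -1 < a -> -1 < b ->
  {in `]u, v[, forall x : R, 0 <= endpoint_sum a b x}.
Proof.
by move=> a1 b1 x _; apply: addr_ge0; apply: mulr_ge0; rewrite ?powR_ge0//; lra.
Qed.

Let integral_endpoint_sum a b : -1 < a -> -1 < b ->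
  (\int[mu]_(x in `]u, v[) (endpoint_sum a b x)%:E =
   (d `^ (a + 1) + d `^ (b + 1))%:E)%E.
Proof.
move=> a1 b1; have a0 : 0 < a + 1 by lra.
have b0 : 0 < b + 1 by lra.
rewrite (@ge0_integral_oo_FTC _ _ (endpoint_diff a b) u v
  (- d `^ (b + 1)) (d `^ (a + 1)))//.
- by rewrite opprK.
- exact: endpoint_sum_ge0.
- under eq_fun => e.
    rewrite /endpoint_diff (_ : u + e - u = e); last by ring.
    rewrite (_ : v - (u + e) = d - e); last by rewrite /d; ring.
    over.
  rewrite -[- _]add0r; apply: cvgB; first exact: powR_near0.
  exact: powR_near.
- under eq_fun => e.
    rewrite /endpoint_diff (_ : v - (v - e) = e); last by ring.
    rewrite (_ : v - e - u = d - e); last by rewrite /d; ring.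
    over.
  rewrite -[d `^ (a + 1)]subr0; apply: cvgB; last exact: powR_near0.
  exact: powR_near.
Qed.

Let measurable_endpoint_sum a b (D : set R) : measurable_fun D (endpoint_sum a b).
Proof.
apply: (measurable_funS measurableT) => //.
by apply: measurable_funD; apply: measurable_funM => //;
  apply: (measurableT_comp (measurable_powR _)); apply: measurable_funB.
Qed.

Let integrable_endpoint_sum a b : -1 < a -> -1 < b ->
  mu.-integrable `]u, v[ (EFin \o endpoint_sum a b).
Proof.
move=> a1 b1; apply/integrableP; split.
  apply/measurable_EFinP; apply: measurable_endpoint_sum.
under eq_integral => x xuv.
  rewrite /= ger0_norm; last by apply: endpoint_sum_ge0 => //; exact: set_mem xuv.
  over.
by rewrite integral_endpoint_sum// ltry.
Qed.

Lemma jweight_ge0 a b x : 0 <= jweight a b x.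
Proof. by rewrite mulr_ge0// powR_ge0. Qed.

Lemma jweight_gt0 a b x : x \in `]u, v[ -> 0 < jweight a b x.
Proof.
by rewrite in_itv /= => /andP[ux xv]; rewrite mulr_gt0// powR_gt0// subr_gt0.
Qed.

Let powR_add1 c x : 0 < x -> x `^ (c + 1) = x * x `^ c.
Proof.
move=> x0; rewrite powRD; last by apply/implyP => _; rewrite gt_eqF.
by rewrite powRr1 ?ltW// mulrC.
Qed.

Lemma jweightSl a b x : x \in `]u, v[ ->
  jweight (a + 1) b x = (x - u) * jweight a b x.
Proof.
by rewrite in_itv /= => /andP[ux xv]; rewrite /jweight powR_add1 ?subr_gt0// mulrA.
Qed.

Lemma jweightSr a b x : x \in `]u, v[ ->
  jweight a (b + 1) x = (v - x) * jweight a b x.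
Proof.
by rewrite in_itv /= => /andP[ux xv]; rewrite /jweight powR_add1 ?subr_gt0// mulrCA.
Qed.

Let powR_le c x : 0 <= c -> 0 <= x <= d -> x `^ c <= d `^ c.
Proof.
move=> c0 /andP[x0 xd]; apply: ge0_ler_powR => //; rewrite nnegrE//.
exact: le_trans xd.
Qed.

(** On the interval, (v - u) jweight = (x - u) jweight + (v - x) jweight. In the
first summand the power of x - u is bounded, in the second that of v - x, so the
sum is at most a multiple of endpoint_sum. *)
Lemma integrable_jweight a b : -1 < a -> -1 < b ->
  mu.-integrable `]u, v[ (EFin \o jweight a b).
Proof.
move=> a1 b1.
have a0 : 0 < a + 1 by lra.
have b0 : 0 < b + 1 by lra.
(* The powers have the coefficients a + 1 and b + 1 in endpoint_sum, hence the
   quotients. *)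
pose K := d^-1 * (d `^ (b + 1) / (a + 1) + d `^ (a + 1) / (b + 1)).
have K0 : 0 <= K.
  by rewrite mulr_ge0// ?invr_ge0 ?(ltW d0)// addr_ge0// divr_ge0// ?powR_ge0// ltW.
apply: (@le_integrable _ _ _ mu `]u, v[%classic _ _
  (fun x => (K * endpoint_sum a b x)%:E)) => //.
- by apply/measurable_EFinP; apply: measurable_jweight.
- move=> x xuv; rewrite /= lee_fin ger0_norm ?jweight_ge0// ger0_norm; last first.
    by rewrite mulr_ge0// endpoint_sum_ge0.
  have /andP[ux xv] : u < x < v by move: xuv; rewrite /= in_itv.
  have xu0 : 0 <= x - u by lra.
  have vx0 : 0 <= v - x by lra.
  have h1 : (x - u) `^ (a + 1) <= d `^ (a + 1).
    by apply: powR_le; [lra | rewrite xu0 /= /d; lra].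
  have h2 : (v - x) `^ (b + 1) <= d `^ (b + 1).
    by apply: powR_le; [lra | rewrite vx0 /= /d; lra].
  have p1 := powR_ge0 (x - u) a; have p2 := powR_ge0 (v - x) b.
  have dE : d * jweight a b x = jweight (a + 1) b x + jweight a (b + 1) x.
    by rewrite jweightSl// jweightSr// -mulrDl; congr (_ * _); rewrite /d; ring.
  rewrite -(ler_pM2l d0) dE /K !mulrA divff ?gt_eqF// mul1r.
  rewrite /jweight /endpoint_sum addrC.
  apply: (@le_trans _ _ ((x - u) `^ a * d `^ (b + 1) + d `^ (a + 1) * (v - x) `^ b)).
    by apply: lerD; [exact: ler_wpM2l | exact: ler_wpM2r].
  set A := d `^ (a + 1); set B := d `^ (b + 1).
  have A0 : 0 <= A by exact: powR_ge0.
  have B0 : 0 <= B by exact: powR_ge0.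
  rewrite -subr_ge0.
  set p := (x - u) `^ a; set q := (v - x) `^ b.
  rewrite [leRHS](_ : _ = B * (b + 1) / (a + 1) * q + A * (a + 1) / (b + 1) * p).
    by rewrite addr_ge0// mulr_ge0 ?powR_ge0// divr_ge0 ?mulr_ge0// ltW.
  by field; rewrite !gt_eqF.
- exact: integrableRZl _ (integrable_endpoint_sum a1 b1).
Qed.

Lemma jmass_gt0 a b : -1 < a -> -1 < b -> 0 < jmass a b.
Proof.
move=> a1 b1; have iw := integrable_jweight a1 b1.
rewrite lt_neqAle Rintegral_ge0 ?andbT; last by move=> x _; exact: jweight_ge0.
apply/eqP => /esym w0.
have : (\int[mu]_(x in `]u, v[) `|(jweight a b x)%:E| = 0)%E.
  under eq_integral do rewrite /= ger0_norm ?jweight_ge0//.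
  rewrite -[RHS]/(0%:E) -w0 /jmass /Rintegral fineK//.
  exact: integrable_fin_num.
have mD : measurable (`]u, v[%classic : set R) by exact: measurable_itv.
have /integrableP[mw _] := iw.
move=> /(ae_eq_integral_abs mu mD mw)[N [mN N0 sub]].
have : (mu `]u, v[%classic <= mu N)%E.
  apply: le_measure; rewrite ?inE//.
  move=> x xuv; apply: sub => /= /(_ xuv) /eqP.
  by rewrite eqe gt_eqF// jweight_gt0.
rewrite N0 lebesgue_measure_itv /= lte_fin uv -EFinB lee_fin.
by rewrite leNgt d0.
Qed.

(** Integration by parts: the difference f of the two integrands is the derivative of
the weight with exponents (a + 1, b + 1), which vanishes at both endpoints. As f
changes sign, a multiple of endpoint_sum, whose integral is known, is added to
make it nonnegative. *)
Lemma jmass_exchange a b : -1 < a -> -1 < b ->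
  (a + 1) * jmass a (b + 1) = (b + 1) * jmass (a + 1) b.
Proof.
move=> a1 b1.
have a0 : 0 < a + 1 by lra.
have b0 : 0 < b + 1 by lra.
pose f x := (a + 1) * jweight a (b + 1) x - (b + 1) * jweight (a + 1) b x.
pose F x := jweight (a + 1) (b + 1) x.
(* The negative part of f is at most (b + 1) (v - u)^(a + 1) (v - x)^b. *)
pose K := d `^ (a + 1).
have i1 : mu.-integrable `]u, v[ (EFin \o jweight a (b + 1)).
  by apply: integrable_jweight; lra.
have i2 : mu.-integrable `]u, v[ (EFin \o jweight (a + 1) b).
  by apply: integrable_jweight; lra.
have i3 := integrable_endpoint_sum a1 b1.
have i4 : mu.-integrable `]u, v[ (EFin \o (fun x => (a + 1) * jweight a (b + 1) x)).
  exact: integrableRZl.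
have i5 : mu.-integrable `]u, v[ (EFin \o (fun x => (b + 1) * jweight (a + 1) b x)).
  exact: integrableRZl.
have i6 : mu.-integrable `]u, v[ (EFin \o f).
  exact: (integrableB _ i4 i5).
have i7 : mu.-integrable `]u, v[ (EFin \o (fun x => K * endpoint_sum a b x)).
  exact: integrableRZl.
have FTC : (\int[mu]_(x in `]u, v[) (f x + K * endpoint_sum a b x)%:E =
    (K * d `^ (a + 1) - - (K * d `^ (b + 1)))%:E)%E.
  apply: (@ge0_integral_oo_FTC _ _ (fun x => F x + K * endpoint_diff a b x)) => //.
  - move=> x xuv; have := xuv; rewrite in_itv /= => /andP[ux xv].
    apply: (is_derive_eq (is_deriveD (is_deriveM (is_derive_powR_left (a + 1) ux)
      (is_derive_powR_right (b + 1) xv))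
      (is_deriveZ K (is_derive_endpoint_diff a b xuv)))).
    by rewrite !addrK /f /jweight /GRing.scale /=; ring.
  - move=> x; rewrite in_itv /= => /andP[ux xv]; apply: cvgD; last first.
      apply: cvgM; first exact: cvg_cst.
      by apply: continuous_endpoint_sum; rewrite in_itv /= ux.
    apply: cvgB; apply: cvgM; try exact: cvg_cst; apply: cvgM;
      try exact: is_derive_continuous (is_derive_powR_left _ ux);
      exact: is_derive_continuous (is_derive_powR_right _ xv).
  - move=> x xuv; have := xuv; rewrite in_itv /= => /andP[ux xv].
    rewrite /f /endpoint_sum mulrDr addrACA addr_ge0//.
      by rewrite addr_ge0// !mulr_ge0 ?powR_ge0 ?jweight_ge0// ltW.
    rewrite addrC mulrCA -mulrBr mulr_ge0 ?(ltW b0)// /jweight -mulrBl.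
    rewrite mulr_ge0 ?powR_ge0// subr_ge0; apply: powR_le; first exact: ltW.
    by rewrite /d; apply/andP; split; lra.
  - have -> : - (K * d `^ (b + 1)) = 0 * d `^ (b + 1) + K * (0 - d `^ (b + 1)).
      by ring.
    under eq_fun => e.
      rewrite /F /jweight /endpoint_diff (_ : u + e - u = e); last by ring.
      rewrite (_ : v - (u + e) = d - e); last by rewrite /d; ring.
      over.
    have h0 := powR_near0 a0; have hd := @powR_near (b + 1).
    exact: cvgD (cvgM h0 hd) (cvgM (cvg_cst K) (cvgB h0 hd)).
  - have -> : K * d `^ (a + 1) = d `^ (a + 1) * 0 + K * (d `^ (a + 1) - 0).
      by ring.
    under eq_fun => e.
      rewrite /F /jweight /endpoint_diff (_ : v - (v - e) = e); last by ring.
      rewrite (_ : v - e - u = d - e); last by rewrite /d; ring.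
      over.
    have h0 := powR_near0 b0; have hd := @powR_near (a + 1).
    exact: cvgD (cvgM hd h0) (cvgM (cvg_cst K) (cvgB hd h0)).
have : \int[mu]_(x in `]u, v[) (f x + K * endpoint_sum a b x) =
   K * \int[mu]_(x in `]u, v[) endpoint_sum a b x.
  by rewrite /Rintegral FTC integral_endpoint_sum//= opprK mulrDr.
rewrite (RintegralD _ i6 i7)// (RintegralZl _ _ i3)//.
move/eqP; rewrite -subr_eq0 addrK (RintegralB _ i4 i5)//.
rewrite (RintegralZl _ _ i1)// (RintegralZl _ _ i2)//.
by rewrite subr_eq0 => /eqP.
Qed.

Lemma jmass_split a b : -1 < a -> -1 < b ->
  (v - u) * jmass a b = jmass (a + 1) b + jmass a (b + 1).
Proof.
move=> a1 b1.
rewrite /jmass -RintegralZl ?integrable_jweight// -RintegralD//;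
  try by apply: integrable_jweight; lra.
apply: eq_Rintegral => x /set_mem xuv.
by rewrite jweightSl// jweightSr// -mulrDl; congr (_ * _); ring.
Qed.

(** The weights with exponents (a + 1, b) and (a, b + 1) add up to v - u times the
weight, and jmass_exchange gives their proportion. *)
Lemma jmassSl a b : -1 < a -> -1 < b ->
  jmass (a + 1) b = (v - u) * ((a + 1) / (a + b + 2) * jmass a b).
Proof.
move=> a1 b1; have ab : a + b + 2 != 0 by rewrite gt_eqF//; lra.
have ex := jmass_exchange a1 b1; have sp := jmass_split a1 b1.
apply: (mulIf ab); rewrite mulrCA sp.
transitivity ((a + 1) * jmass (a + 1) b + (b + 1) * jmass (a + 1) b); first by ring.
by rewrite -ex; field.
Qed.

End JacobiWeight.

(** * Integrals of polynomials against the Jacobi weight *)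

Section BetaIntegral.
Variables (R : realType) (u v : R).
Hypothesis uv : u < v.
Notation mu := (@lebesgue_measure R).
Implicit Types (a b c x : R).
Notation jweight := (jweight u v).
Notation jmass := (jmass u v).

Let rescale x := (x - u) / (v - u).

(** One factor of the power is absorbed into the weight, whose exponent a rises
by one; jmassSl then gives one factor of each Pochhammer symbol. *)
Lemma jweight_power i a b : -1 < a -> -1 < b ->
  mu.-integrable `]u, v[ (EFin \o (fun x => rescale x ^+ i * jweight a b x)) /\
  \int[mu]_(x in `]u, v[) (rescale x ^+ i * jweight a b x) =
  jmass a b * (poch (a + 1) i / poch (a + b + 2) i).
Proof.
have d0 : v - u != 0 by rewrite gt_eqF// subr_gt0.
elim: i a => [|i IHi] a a1 b1.
  split; last first.
    rewrite !poch0 divr1 mulr1; apply: eq_Rintegral => x _.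
    by rewrite expr0 mul1r.
  apply: (eq_integrable _ _ _ _ (integrable_jweight uv a1 b1)) => //= x _.
  by rewrite expr0 mul1r.
have a1' : -1 < a + 1 by lra.
have [iw ew] := IHi _ a1' b1.
have e x : x \in `]u, v[%classic ->
    (v - u)^-1 * (rescale x ^+ i * jweight (a + 1) b x) =
    rescale x ^+ i.+1 * jweight a b x.
  by move/set_mem => xuv; rewrite jweightSl// exprSr /rescale; ring.
split.
  apply: (eq_integrable _ _ _ _ (integrableRZl (v - u)^-1 _ iw)) => //=.
  by move=> x xuv; rewrite e.
have <- : \int[mu]_(x in `]u, v[)
    ((v - u)^-1 * (rescale x ^+ i * jweight (a + 1) b x)) =
    \int[mu]_(x in `]u, v[) (rescale x ^+ i.+1 * jweight a b x).
  exact: eq_Rintegral.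
rewrite RintegralZl// ew jmassSl// mulrA mulKf//.
rewrite !poch_recl (_ : a + 1 + b + 2 = a + b + 2 + 1); last by ring.
have n1 : poch (a + b + 2 + 1) i != 0 by apply: poch_neq0; lra.
have n2 : a + b + 2 != 0 by rewrite gt_eqF//; lra.
by field; rewrite n1.
Qed.

Lemma Rintegral_poly_jweight (p : {poly R}) a b : -1 < a -> -1 < b ->
  \int[mu]_(x in `[u, v]) (p.[(x - u) / (v - u)] * jweight a b x) =
  jmass a b * bmean a b p.
Proof.
move=> a1 b1.
pose term (i : nat) x := p`_i * (rescale x ^+ i * jweight a b x).
have iterm i : mu.-integrable `]u, v[ (EFin \o term i).
  by apply: integrableRZl => //; have [] := jweight_power i a1 b1.
have sumP n : mu.-integrable `]u, v[ (EFin \o (fun x => \sum_(i < n) term i x)) /\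
   \int[mu]_(x in `]u, v[) (\sum_(i < n) term i x) =
   jmass a b * \sum_(i < n) p`_i * (poch (a + 1) i / poch (a + b + 2) i).
  elim: n => [|n [isum esum]].
    split.
      apply: (eq_integrable _ _ _ _ (integrable0 _ _)) => //= x _.
      by rewrite big_ord0.
    under eq_Rintegral do rewrite big_ord0.
    by rewrite big_ord0 mulr0 Rintegral_cst// mul0r.
  split.
    apply: (eq_integrable _ _ _ _ (integrableD _ isum (iterm n))) => //= x _.
    by rewrite big_ord_recr.
  under eq_Rintegral do rewrite big_ord_recr.
  rewrite RintegralD// esum big_ord_recr mulrDr; congr (_ + _).
  have [ipow epow] := jweight_power n a1 b1.
  by rewrite RintegralZl// epow; ring.
rewrite -(sumP _).2 /Rintegral -(@integral_itv_bndoo _ u v _ true false); last first.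
  by have /integrableP[] := (sumP (size p)).1.
congr fine; apply: eq_integral => x _.
rewrite horner_coef mulr_suml; congr EFin.
by apply: eq_bigr => i _; rewrite /term -mulrA.
Qed.

End BetaIntegral.

(** * Jacobi polynomials on the unit interval *)

Section ShiftedJacobi.
Variable R : realType.
Implicit Types (a b c : R) (n m : nat) (p q : {poly R}).

(** The Jacobi polynomial P_n^(b,a)(2 x - 1), in powers of x. The exponents are in
the order of the weight x^a (1 - x)^b, opposite to that of the classical name.
The expansion at 0 rather than 1 makes every mean against a power of 1 - x a
Chu-Vandermonde sum. *)
Definition sjacobi a b n : {poly R} :=
  ((-1) ^+ n * poch (a + 1) n / n`!%:R) *:
  \poly_(k < n.+1) ((-1) ^+ k *+ 'C(n, k)
                    * (poch (n%:R + a + b + 1) k / poch (a + 1) k)).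

Lemma sjacobi0 a b : sjacobi a b 0 = 1.
Proof.
rewrite /sjacobi poly_def big_ord1 !poch0 bin0 !expr0 fact0.
by rewrite !divr1 !mulr1 !scale1r.
Qed.

Lemma size_sjacobi a b n : -1 < a -> -1 < b -> size (sjacobi a b n) = n.+1.
Proof.
move=> a1 b1; case: n => [|n]; first by rewrite sjacobi0 size_poly1.
have a0 : 0 < a + 1 by lra.
have b0 : 0 < b + 1 by lra.
rewrite size_scale; last first.
  by rewrite !mulf_neq0 ?signr_eq0 ?poch_neq0 ?invr_eq0.
rewrite size_poly_eq// binn mulf_neq0 ?signr_eq0// mulf_neq0 ?invr_eq0 ?poch_neq0//.
by have : 0 <= n%:R :> R by []; rewrite -natr1; lra.
Qed.

Lemma lead_coef_sjacobi a b n : -1 < a ->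
  (sjacobi a b n)`_n = poch (n%:R + a + b + 1) n / n`!%:R.
Proof.
move=> a1; have a0 : 0 < a + 1 by lra.
rewrite coefZ coef_poly ltnSn binn mulr1n -[RHS]mul1r -[X in _ = X * _](sign_mul_self R n).
have pa := poch_neq0 n a0; field.
by rewrite pa fact_neq0.
Qed.

Lemma sjacobi_at1 a b n : -1 < a -> -1 < b ->
  (sjacobi a b n).[1] = poch (b + 1) n / n`!%:R.
Proof.
move=> a1 b1; have a0 : 0 < a + 1 by lra.
rewrite hornerZ horner_poly.
under eq_bigr do rewrite expr1n mulr1.
rewrite chu_vandermonde//.
rewrite (_ : a + 1 - _ = - (b + 1) - n%:R + 1); last by ring.
rewrite poch_reflect.
have pa := poch_neq0 n a0.
rewrite -[RHS]mul1r -[X in _ = X * _](sign_mul_self R n); field.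
by rewrite pa fact_neq0.
Qed.

(** The exponent g is independent of the parameter b of the polynomial, since the
Chu-Vandermonde sum has a free lower parameter. The values g = b + j give the
pairing with (1 - x)^j, and g = b - 1 the mean in bmean_qrestr. *)
Lemma bmean_sjacobi a b g n : -1 < a -> -1 < g ->
  bmean a g (sjacobi a b n) =
  (-1) ^+ n * poch (a + 1) n / n`!%:R *
  (poch (g - b - n%:R + 1) n / poch (a + g + 2) n).
Proof.
move=> a1 g1; have a0 : 0 < a + 1 by lra.
rewrite linearZ poly_def linear_sum /GRing.scale /=; congr (_ * _).
rewrite (_ : g - b - n%:R + 1 = a + g + 2 - (n%:R + a + b + 1)); last by ring.
rewrite -chu_vandermonde; last by lra.
apply: eq_bigr => i _; rewrite linearZ /= bmeanXn /GRing.scale /= -mulrA.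
congr (_ * _); have pa := poch_neq0 i a0; rewrite mulrA divfK//.
Qed.

Lemma bmean_sjacobi_mul_1subXn a b n j : -1 < a -> -1 < b ->
  bmean a b (sjacobi a b n * (1 - 'X) ^+ j) =
  poch (b + 1) j / poch (a + b + 2) j * ((-1) ^+ n * poch (a + 1) n / n`!%:R *
  (poch (j.+1%:R - n%:R) n / poch (a + b + j%:R + 2) n)).
Proof.
move=> a1 b1; rewrite mulrC bmean_mul_1subXn// bmean_sjacobi//; last first.
  by rewrite ltr_wpDr.
congr (_ * (_ * (poch _ _ / poch _ _))); last by ring.
by rewrite -natr1; ring.
Qed.

Lemma poly_expand_1subX p : p =
  \sum_(i < size p) (p \Po (1 - 'X))`_i *: (1 - 'X) ^+ i.
Proof.
have s : size (1 - 'X : {poly R}) = 2.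
  by rewrite -opprB size_polyN size_XsubC.
rewrite -(size_comp_poly2 p s) -comp_polyE -comp_polyA.
by rewrite comp_polyB comp_polyX comp_polyC opprB addrCA subrr addr0 comp_polyXr.
Qed.

Lemma coef_exp_1subX n i : (i <= n)%N ->
  ((1 - 'X) ^+ i : {poly R})`_n = (-1) ^+ n *+ (n == i).
Proof.
have -> : (1 - 'X) ^+ i = (-1) ^+ i *: ('X - 1%:P) ^+ i :> {poly R}.
  by rewrite -exprZn scaleN1r opprB.
rewrite coefZ leq_eqVlt => /predU1P[->|lt_in].
  have /monicP := monic_exp n (monicXsubC (1 : R)).
  by rewrite lead_coefE size_exp_XsubC /= eqxx => ->; rewrite mulr1.
by rewrite nth_default ?mulr0 ?gtn_eqF// size_exp_XsubC.
Qed.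

(** In the expansion of q in powers of 1 - x, the pairing with (1 - x)^j is a
multiple of (j + 1 - n)_n, which is zero for j < n; the term j = n remains. *)
Lemma bmean_sjacobi_mul a b n q : -1 < a -> -1 < b -> (size q <= n.+1)%N ->
  bmean a b (sjacobi a b n * q) =
  q`_n * (poch (a + 1) n * poch (b + 1) n / poch (a + b + 2) (n + n)).
Proof.
move=> a1 b1 qn; have ab : 0 < a + b + 2 by lra.
pose r := q \Po (1 - 'X).
have s1 : size (1 - 'X : {poly R}) = 2.
  by rewrite -opprB size_polyN size_XsubC.
(* The expansion of q in powers of 1 - x; r lists its coefficients. *)
have qE : q = \sum_(i < n.+1) r`_i *: (1 - 'X) ^+ i.
  rewrite {1}[q]poly_expand_1subX (big_ord_widen n.+1 (fun i => r`_i *: (1 - 'X) ^+ i))//.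
  rewrite big_mkcond; apply: eq_bigr => i _; case: ltnP => // qi.
  by rewrite nth_default ?scale0r// size_comp_poly2.
have rn : r`_n = (-1) ^+ n * q`_n.
  rewrite {1}qE coef_sum big_ord_recr big1 /=; last first.
    by move=> i _; rewrite coefZ coef_exp_1subX ?(ltnW (ltn_ord i))// gtn_eqF ?mulr0.
  by rewrite add0r coefZ coef_exp_1subX// eqxx mulr1n mulrCA sign_mul_self mulr1.
rewrite {1}qE mulr_sumr linear_sum big_ord_recr big1 /=; last first.
  move=> i _; rewrite -scalerAr linearZ /= bmean_sjacobi_mul_1subXn//.
  by rewrite poch_opp_nat// mul0r !mulr0 scaler0.
rewrite add0r -scalerAr linearZ /= bmean_sjacobi_mul_1subXn// rn.
rewrite (_ : n.+1%:R - n%:R = 1); last by rewrite -natr1; ring.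
rewrite poch_nat poch_add.
rewrite (_ : a + b + n%:R + 2 = a + b + 2 + n%:R); last by ring.
have p1 := poch_neq0 n ab.
have p2 : poch (a + b + 2 + n%:R) n != 0 by rewrite poch_neq0// ltr_wpDr.
rewrite -[RHS]mul1r -[X in _ = X * _](sign_mul_self R n) /GRing.scale /=; field.
by rewrite p1 p2 fact_neq0.
Qed.

Lemma sjacobi_orthogonal a b n q : -1 < a -> -1 < b -> (size q <= n)%N ->
  bmean a b (sjacobi a b n * q) = 0.
Proof.
move=> a1 b1 qn; rewrite bmean_sjacobi_mul//; last exact: leqW.
by rewrite nth_default// mul0r.
Qed.

(** If p has degree m, its pairing with the m-th Jacobi polynomial is a nonzero
multiple of its leading coefficient. *)
Lemma bmean_nondegenerate a b n p : -1 < a -> -1 < b -> (size p <= n)%N ->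
  (forall q, (size q <= n)%N -> bmean a b (p * q) = 0) -> p = 0.
Proof.
move=> a1 b1 pn po; apply/eqP; apply: contraT => p0.
have [m sp] : exists m, size p = m.+1.
  by exists (size p).-1; rewrite prednK// lt0n size_poly_eq0.
have pm : p`_m != 0 by rewrite -[m]/(m.+1.-1) -sp -lead_coefE lead_coef_eq0.
have := po (sjacobi a b m); rewrite size_sjacobi// -sp => /(_ pn) /eqP.
rewrite mulrC bmean_sjacobi_mul//; last by rewrite sp.
rewrite mulf_eq0 (negPf pm) gt_eqF//; apply: divr_gt0; last by apply: poch_gt0; lra.
by apply: mulr_gt0; apply: poch_gt0; lra.
Qed.

(** The multiple of the Jacobi polynomial with the same leading coefficient
differs from p by a polynomial of degree less than n that is orthogonal to all
of them, hence zero; the value at 1 fixes the multiple. *)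
Lemma sjacobi_unique a b n p : -1 < a -> -1 < b -> (size p <= n.+1)%N ->
  (forall q, (size q <= n)%N -> bmean a b (p * q) = 0) ->
  p.[1] = (sjacobi a b n).[1] -> p = sjacobi a b n.
Proof.
move=> a1 b1 pn po p1; have sS := size_sjacobi n a1 b1.
have S0 : (sjacobi a b n)`_n != 0.
  by rewrite -[n in _`_n]/(n.+1.-1) -sS -lead_coefE lead_coef_eq0 -size_poly_eq0 sS.
pose c := p`_n / (sjacobi a b n)`_n.
have pE : p = c *: sjacobi a b n.
  apply/eqP; rewrite -subr_eq0; apply/eqP.
  apply: (@bmean_nondegenerate a b n) => // [|q qn].
    apply/leq_sizeP => j; rewrite leq_eqVlt => /predU1P[<-|nj].
      by rewrite coefB coefZ divfK// subrr.
    by rewrite coefB coefZ !nth_default ?mulr0 ?subrr ?sS// (leq_trans pn).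
  rewrite mulrBl linearB /= po// -scalerAl linearZ /= sjacobi_orthogonal//.
  by rewrite scaler0 subr0.
move: p1; rewrite {1}pE hornerZ => /eqP.
rewrite -subr_eq0 -{2}[(sjacobi a b n).[1]]mul1r -mulrBl mulf_eq0.
rewrite sjacobi_at1// mulf_eq0 invr_eq0 pnatr_eq0 eqn0Ngt fact_gt0.
have pb : poch (b + 1) n != 0 by apply: poch_neq0; lra.
rewrite /= orbF (negPf pb) orbF subr_eq0.
by move=> /eqP c1; rewrite pE c1 scale1r.
Qed.

End ShiftedJacobi.

(** * Transfer from the interval [-1, 1] *)

Section JacobiOnUnitInterval.
Variable R : realType.
Notation mu := (@lebesgue_measure R).
Implicit Types (a b c : R) (n m : nat) (p q : {poly R}).

(** The change of variable t = 2 x - 1, as a polynomial to compose with. *)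
Definition to_sym : {poly R} := 2 *: 'X - 1.
Definition to_unit : {poly R} := 2^-1 *: ('X + 1).

Lemma size_to_sym : size to_sym = 2.
Proof.
rewrite /to_sym size_polyDl size_scale ?size_polyX ?pnatr_eq0//.
by rewrite size_polyN size_poly1.
Qed.

Lemma size_to_unit : size to_unit = 2.
Proof. by rewrite size_scale ?invr_eq0 ?pnatr_eq0// -[1]/(1%:P) size_XaddC. Qed.

Lemma to_symK p : (p \Po to_unit) \Po to_sym = p.
Proof.
rewrite -comp_polyA comp_polyZ comp_polyD comp_polyX.
rewrite -[1 \Po _]/(1%:P \Po _) comp_polyC subrK scalerA mulVf ?pnatr_eq0//.
by rewrite scale1r comp_polyXr.
Qed.

Lemma to_unitK p : (p \Po to_sym) \Po to_unit = p.
Proof.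
rewrite -comp_polyA comp_polyB comp_polyZ comp_polyX.
rewrite -[1 \Po _]/(1%:P \Po _) comp_polyC scalerA divff ?pnatr_eq0//.
by rewrite scale1r addrK comp_polyXr.
Qed.

Lemma horner_to_sym p x : (p \Po to_sym).[x] = p.[2 * x - 1].
Proof. by rewrite horner_comp /to_sym !hornerE. Qed.

Lemma rbinom_poch b n : rbinom (n%:R + b) n = poch (b + 1) n / n`!%:R.
Proof.
congr (_ / _); rewrite /poch -(big_mkord xpredT (fun i => n%:R + b - i%:R)).
rewrite big_nat_rev /= big_mkord; apply: eq_bigr => i _.
by rewrite add0n natrB// -natr1; ring.
Qed.

Lemma Rintegral_sym p a b : -1 < a -> -1 < b ->
  \int[mu]_(t in `[(-1 : R), 1]) (p.[t] * ((1 - t) `^ b * (1 + t) `^ a)) =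
  jmass (-1) 1 a b * bmean a b (p \Po to_sym).
Proof.
move=> a1 b1; have lt11 : -1 < 1 :> R by lra.
rewrite -(Rintegral_poly_jweight lt11 _ a1 b1); apply: eq_Rintegral => t _.
rewrite horner_to_sym /jweight opprK; congr (_.[_] * _).
  by field.
by rewrite mulrC [1 + t]addrC.
Qed.

(** Composition with the affine map preserves degrees, and both integrals are
positive multiples of bmean. *)
Lemma is_jacobiP a b n p : -1 < a -> -1 < b -> is_jacobi b a n p <->
  [/\ size (p \Po to_sym) = n.+1,
      forall q, (size q <= n)%N -> bmean a b ((p \Po to_sym) * q) = 0 &
      (p \Po to_sym).[1] = poch (b + 1) n / n`!%:R].
Proof.
move=> a1 b1; have lt11 : -1 < 1 :> R by lra.
have m0 := jmass_gt0 lt11 a1 b1.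
have e1 : 2 * 1 - 1 = 1 :> R by lra.
rewrite /is_jacobi (size_comp_poly2 p size_to_sym) horner_to_sym e1 rbinom_poch.
have orthE q : \int[mu]_(t in `[(-1 : R), 1])
    (p.[t] * q.[t] * ((1 - t) `^ b * (1 + t) `^ a)) =
    jmass (-1) 1 a b * bmean a b ((p \Po to_sym) * (q \Po to_sym)).
  under eq_Rintegral do rewrite -hornerM.
  by rewrite Rintegral_sym// comp_polyM.
split=> -[sp op vp]; split=> // q qn.
  have := op (q \Po to_unit); rewrite orthE to_symK.
  rewrite (size_comp_poly2 q size_to_unit) => /(_ qn) /eqP.
  by rewrite mulf_eq0 gt_eqF//= => /eqP.
by rewrite orthE op ?mulr0// (size_comp_poly2 q size_to_sym).
Qed.

(** The explicit polynomial satisfies the conditions that define the Jacobi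
polynomial, and uniqueness makes it the one that the choice operator returns. *)
Lemma jacobi_to_sym a b n : -1 < a -> -1 < b ->
  jacobi b a n \Po to_sym = sjacobi a b n.
Proof.
move=> a1 b1.
suff -> : jacobi b a n = sjacobi a b n \Po to_unit by rewrite to_symK.
apply: xget_unique => [|p] /=.
  apply/is_jacobiP => //; rewrite to_symK; split.
  - exact: size_sjacobi.
  - by move=> q; exact: sjacobi_orthogonal.
  - exact: sjacobi_at1.
move=> /(is_jacobiP _ _ a1 b1)[sp po p1]; rewrite -[LHS]to_unitK; congr (_ \Po _).
by apply: sjacobi_unique => //; rewrite ?sp// sjacobi_at1.
Qed.

Lemma wconst_Rintegral a b p : -1 < a -> -1 < b ->
  wconst a b * \int[mu]_(x in `[(0 : R), 1]) (p.[x] * weight a b x) = bmean a b p.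
Proof.
move=> a1 b1; have m0 := jmass_gt0 (@ltr01 R) a1 b1.
have intE q : \int[mu]_(x in `[(0 : R), 1]) (q.[x] * weight a b x) =
    jmass 0 1 a b * bmean a b q.
  rewrite -(Rintegral_poly_jweight (@ltr01 R) _ a1 b1).
  apply: eq_Rintegral => x _.
  by rewrite /jweight !subr0 divr1.
rewrite intE /wconst.
have -> : \int[mu]_(x in `[(0 : R), 1]) weight a b x = jmass 0 1 a b.
  rewrite -[RHS]mulr1 -[X in _ = _ * X](bmean1 a b) -intE; apply: eq_Rintegral => x _.
  by rewrite hornerC mul1r.
by rewrite mulKf// gt_eqF.
Qed.

Lemma hnorm_bmean a b n : -1 < a -> -1 < b ->
  hnorm a b n = bmean a b (sjacobi a b n ^+ 2).
Proof.
move=> a1 b1; rewrite -wconst_Rintegral//; congr (_ * _).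
apply: eq_Rintegral => x _.
by rewrite -(jacobi_to_sym n a1 b1) horner_exp horner_to_sym.
Qed.

End JacobiOnUnitInterval.

(** * The restriction of Q_n to one side of the wedge *)

Section WedgeBranch.
Variable R : realType.
Implicit Types (a g : R) (n m : nat) (p q : {poly R}).

(** The restriction of Q_(m+1) to the side y = 1, for a = alpha and g = gamma. The
restriction to x = 1 is - 1 / sigma times the polynomial for a = beta. *)
Definition qrestr a g m : {poly R} :=
  (poch (g + a + 2) m.+1 / poch (a + 1) m) *: ((1 - 'X) * sjacobi a (g + 2) m).

(** The prefactor of Q_n is exactly what makes this mean independent of a. *)
Lemma bmean_qrestr a g m : -1 < a -> -1 < g ->
  bmean a g (qrestr a g m) = g + 1.
Proof.
move=> a1 g1; rewrite linearZ /= bmean_mul_1subX// bmean_sjacobi//; last by lra.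
(* The mean has exponent g + 1, one less than the parameter g + 2. *)
rewrite (_ : g + 1 - _ - _ + 1 = - 1 - m%:R + 1); last by ring.
rewrite poch_reflect poch_nat [g + a + 2](_ : _ = a + g + 2); last by ring.
rewrite poch_recl (_ : a + (g + 1) + 2 = a + g + 2 + 1); last by ring.
have n1 : poch (a + 1) m != 0 by apply: poch_neq0; lra.
have n2 : poch (a + g + 2 + 1) m != 0 by apply: poch_neq0; lra.
have n3 : a + g + 2 != 0 by rewrite gt_eqF//; lra.
rewrite /GRing.scale /= -[RHS]mul1r -[X in _ = X * _](sign_mul_self R m); field.
by rewrite n1 n2 n3 fact_neq0.
Qed.

Lemma bmean_mul_1subX_sq a g p : -1 < a -> -1 < g ->
  bmean a g ((1 - 'X) ^+ 2 * p) =
  poch (g + 1) 2 / poch (a + g + 2) 2 * bmean a (g + 2) p.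
Proof. by move=> a1 g1; rewrite bmean_mul_1subXn. Qed.

(** Evaluation at 1, up to a constant: q - q(1) is divisible by 1 - x, and the
resulting factor (1 - x)^2 changes the weight to the one for which the Jacobi
factor is orthogonal to lower degrees. *)
Lemma bmean_qrestr_mul a g m q : -1 < a -> -1 < g -> (size q <= m.+1)%N ->
  bmean a g (qrestr a g m * q) = (g + 1) * q.[1].
Proof.
move=> a1 g1 qm.
(* r is the quotient of q - q(1) by x - 1, hence the sign below. *)
have /factor_theorem[r qE] : root (q - (q.[1])%:P) 1.
  by rewrite rootE !hornerE subrr.
have rm : (size r <= m)%N.
  have [->|r0] := eqVneq r 0; first by rewrite size_poly0.
  have : (size (q - (q.[1])%:P)%R <= m.+1)%N.
    rewrite (leq_trans (size_polyD _ _))// geq_max qm size_polyN.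
    by rewrite (leq_trans (size_polyC_leq1 _)).
  by rewrite qE size_Mmonic ?monicXsubC// size_XsubC addn2.
have {}qE : q = q.[1] *: 1 - (1 - 'X) * r.
  by rewrite alg_polyC -mulNr opprB mulrC -qE addrC subrK.
rewrite {1}qE mulrBr linearB /= -scalerAr linearZ /= mulr1 bmean_qrestr//.
rewrite /qrestr -scalerAl linearZ /=.
rewrite (_ : _ * _ * _ = (1 - 'X) ^+ 2 * (sjacobi a (g + 2) m * r)); last by ring.
rewrite bmean_mul_1subX_sq// sjacobi_orthogonal//; last by lra.
by rewrite mulr0 scaler0 subr0 /GRing.scale /= mulrC.
Qed.

Lemma bmean_qrestr_sq a g m : -1 < a -> -1 < g ->
  bmean a g (qrestr a g m ^+ 2) =
  poch (g + 1) 2 * poch (a + g + 2) m.+1 ^+ 2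
  / (poch (a + g + 2) 2 * poch (a + 1) m ^+ 2) *
  bmean a (g + 2) (sjacobi a (g + 2) m ^+ 2).
Proof.
move=> a1 g1; rewrite /qrestr exprZn linearZ /= [((1 - 'X) * _) ^+ 2]exprMn.
rewrite bmean_mul_1subX_sq//.
rewrite [g + a + 2](_ : _ = a + g + 2); last by ring.
have n1 : poch (a + 1) m != 0 by apply: poch_neq0; lra.
have n2 : poch (a + g + 2) 2 != 0 by apply: poch_neq0; lra.
rewrite /GRing.scale /=; field.
by rewrite n1 n2.
Qed.

(** The second factor has degree m + 1, so bmean_sjacobi_mul reduces the pairing
to its leading coefficient, which is minus that of its Jacobi factor. *)
Lemma bmean_sjacobi_qrestr a g m : -1 < a -> -1 < g ->
  bmean a g (sjacobi a g m.+1 * qrestr a g m) =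
  - ((a + m.+1%:R) * poch (g + 1) m.+1) / (m`!%:R * (2 * m.+1%:R + g + a + 1)).
Proof.
move=> a1 g1.
have g2 : -1 < g + 2 by lra.
have sS := size_sjacobi m a1 g2.
have n1 : poch (a + 1) m != 0 by apply: poch_neq0; lra.
have n3 : poch (a + g + 2) m.+1 != 0 by apply: poch_neq0; lra.
have m0 : 0 <= m%:R :> R by [].
have n4 : poch (a + g + 2 + m.+1%:R) m != 0.
  by apply: poch_neq0; rewrite -natr1; lra.
have n5 : 2 * m.+1%:R + g + a + 1 != 0 by rewrite gt_eqF// -natr1; lra.
rewrite -scalerAr linearZ /= bmean_sjacobi_mul//; last first.
  rewrite mulrBl mul1r (leq_trans (size_polyD _ _))// geq_max sS leqnSn /=.
  by rewrite size_polyN (leq_trans (size_polyMleq _ _))// size_polyX sS.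
rewrite mulrBl mul1r coefB coefXM /= nth_default ?sS//.
rewrite lead_coef_sjacobi// [poch (a + 1) m.+1]pochS poch_add.
rewrite [poch (_ + m.+1%:R) m.+1]pochS.
rewrite (_ : m%:R + a + (g + 2) + 1 = a + g + 2 + m.+1%:R); last first.
  by rewrite -natr1; ring.
rewrite [g + a + 2](_ : _ = a + g + 2); last by ring.
rewrite [a + g + 2 + m.+1%:R + m%:R](_ : _ = 2 * m.+1%:R + g + a + 1); last first.
  by rewrite -natr1; ring.
rewrite [a + 1 + m%:R](_ : _ = a + m.+1%:R); last by rewrite -natr1; ring.
rewrite /GRing.scale /=; move: (m.+1%:R) n4 n5 => M n4 n5; field.
by rewrite n1 n3 n4 n5 fact_neq0.
Qed.

End WedgeBranch.

(** * Polynomials on the wedge *)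

Section Wedge.
Variable R : realType.
Variables (sigma alpha beta gamma : R).
Hypotheses (halpha : -1 < alpha) (hbeta : -1 < beta) (hgamma : -1 < gamma)
    (hsigma : 0 < sigma).
Implicit Types (f g q : {mpoly R[2]}).

Lemma bip_bmean f g (F G F' G' : {poly R}) :
  (forall x, beval f x 1 = F.[x]) -> (forall y, beval f 1 y = F'.[y]) ->
  (forall x, beval g x 1 = G.[x]) -> (forall y, beval g 1 y = G'.[y]) ->
  bip sigma alpha beta gamma f g =
  bmean alpha gamma (F * G) + sigma * bmean beta gamma (F' * G').
Proof.
move=> fF fF' gG gG'; rewrite /bip -!wconst_Rintegral// mulrA.
by congr (_ * _ + _ * _); apply: eq_Rintegral => x _;
  rewrite hornerM ?fF ?gG ?fF' ?gG'.
Qed.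

Lemma bevalZ c f x y : beval (c *: f) x y = c * beval f x y.
Proof. exact: mevalZ. Qed.

Lemma bevalC c x y : beval (c%:MP : {mpoly R[2]}) x y = c.
Proof. exact: mevalC. Qed.

Lemma beval_horner_alg f (p : {poly R}) x y :
  beval (horner_alg f p) x y = p.[beval f x y].
Proof.
elim/poly_ind: p => [|p c IHp].
  by rewrite raddf0 horner0 -(scale0r 1) bevalZ mul0r.
rewrite rmorphD rmorphM /= horner_algX horner_algC hornerMXaddC.
by rewrite bevalD bevalM IHp bevalZ beval1 mulr1.
Qed.

Lemma beval_in_x (p : {poly R}) x y : beval (in_x p) x y = p.[2 * x - 1].
Proof.
rewrite beval_horner_alg bevalD bevalN bevalM bevalX beval1.
by rewrite -[2%:R in LHS]mpolyC_nat bevalC.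
Qed.

Lemma beval_in_y (p : {poly R}) x y : beval (in_y p) x y = p.[2 * y - 1].
Proof.
rewrite beval_horner_alg bevalD bevalN bevalM bevalY beval1.
by rewrite -[2%:R in LHS]mpolyC_nat bevalC.
Qed.

Let two1B1 : 2 * 1 - 1 = 1 :> R. Proof. by lra. Qed.

Let jacobi_at1 a n : -1 < a -> (jacobi gamma a n).[1] = rbinom (n%:R + gamma) n.
Proof.
move=> a1; rewrite rbinom_poch -(sjacobi_at1 n a1 hgamma) -jacobi_to_sym//.
by rewrite horner_to_sym two1B1.
Qed.

Lemma beval_Ppoly_x n x :
  beval (Ppoly alpha beta gamma n) x 1 = (sjacobi alpha gamma n).[x].
Proof.
case: n => [|n]; first by rewrite beval1 sjacobi0 hornerC.
rewrite /Ppoly 2!bevalD bevalN bevalC.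
rewrite -[RHS](addrK (rbinom (n.+1%:R + gamma) n.+1)); congr (_ + _ - _).
  by rewrite beval_in_x -jacobi_to_sym// horner_to_sym.
by rewrite beval_in_y two1B1 jacobi_at1.
Qed.

Lemma beval_Ppoly_y n y :
  beval (Ppoly alpha beta gamma n) 1 y = (sjacobi beta gamma n).[y].
Proof.
case: n => [|n]; first by rewrite beval1 sjacobi0 hornerC.
rewrite /Ppoly 2!bevalD bevalN bevalC.
rewrite -[RHS](addKr (- rbinom (n.+1%:R + gamma) n.+1)) opprK addrA addrAC.
congr (_ + _ - _).
  by rewrite beval_in_x two1B1 jacobi_at1.
by rewrite beval_in_y -jacobi_to_sym// horner_to_sym.
Qed.

Let gamma2 : -1 < gamma + 2. Proof. by have := hgamma; lra. Qed.

Lemma beval_Qpoly_x m x :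
  beval (Qpoly sigma alpha beta gamma m.+1) x 1 = (qrestr alpha gamma m).[x].
Proof.
rewrite bevalD bevalN !bevalZ !bevalM !bevalD !bevalN bevalX bevalY beval1.
rewrite subrr mul0r mulr0 subr0 beval_in_x /qrestr -jacobi_to_sym//.
by rewrite hornerZ hornerM horner_to_sym hornerD hornerN hornerC hornerX.
Qed.

Lemma beval_Qpoly_y m y : beval (Qpoly sigma alpha beta gamma m.+1) 1 y =
  (- sigma^-1 *: qrestr beta gamma m).[y].
Proof.
rewrite bevalD bevalN !bevalZ !bevalM !bevalD !bevalN bevalX bevalY beval1.
rewrite subrr mul0r mulr0 sub0r beval_in_y /qrestr -jacobi_to_sym//.
by rewrite !hornerZ hornerM horner_to_sym hornerD hornerN hornerC hornerX; ring.
Qed.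

(** A monomial x^i y^j restricts to x^i, so the degree does not grow. *)
Lemma beval_restrict_x q n : (msize q <= n)%N ->
  exists2 G : {poly R}, (size G <= n)%N & forall x, beval q x 1 = G.[x].
Proof.
move=> qn; exists (\sum_(m <- msupp q) q@_m *: 'X^(m ord0)).
  rewrite (leq_trans (size_sum _ _ _))//; apply/bigmax_leqP_seq => m mq _.
  rewrite (leq_trans (size_scale_leq _ _))// size_polyXn.
  apply: leq_trans qn; apply: leq_trans (msize_mdeg_lt mq).
  by rewrite ltnS mdegE (bigD1 ord0)//= leq_addr.
move=> x; rewrite /beval mevalE horner_sum; apply: eq_bigr => m _.
rewrite hornerZ hornerXn big_ord_recl big_ord1; congr (_ * _).
by rewrite !(tnth_nth 0) /= expr1n mulr1.
Qed.

Lemma beval_restrict_y q n : (msize q <= n)%N ->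
  exists2 G : {poly R}, (size G <= n)%N & forall y, beval q 1 y = G.[y].
Proof.
move=> qn; exists (\sum_(m <- msupp q) q@_m *: 'X^(m ord_max)).
  rewrite (leq_trans (size_sum _ _ _))//; apply/bigmax_leqP_seq => m mq _.
  rewrite (leq_trans (size_scale_leq _ _))// size_polyXn.
  apply: leq_trans qn; apply: leq_trans (msize_mdeg_lt mq).
  by rewrite ltnS mdegE (bigD1 ord_max)//= leq_addr.
move=> x; rewrite /beval mevalE horner_sum; apply: eq_bigr => m _.
rewrite hornerZ hornerXn big_ord_recr big_ord1; congr (_ * _).
by rewrite !(tnth_nth 0) /= expr1n mul1r.
Qed.

Lemma msizeM_leq f g : (msize (f * g) <= (msize f + msize g).-1)%N.
Proof.
have [->|f0] := eqVneq f 0; first by rewrite mul0r msize0.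
have [->|g0] := eqVneq g 0; first by rewrite mulr0 msize0.
by rewrite msizeM.
Qed.

Lemma msizeD_leq f g n : (msize f <= n)%N -> (msize g <= n)%N ->
  (msize (f + g) <= n)%N.
Proof.
by move=> fn gn; apply: leq_trans (mmeasureD_le _ _ _) _; rewrite geq_max fn.
Qed.

Lemma msize_horner_alg f (p : {poly R}) : (msize f <= 2)%N ->
  (msize (horner_alg f p) <= size p)%N.
Proof.
move=> f2.
have fX i : (msize (f ^+ i) <= i.+1)%N.
  elim: i => [|i IHi]; first by rewrite expr0 msize1.
  rewrite exprS (leq_trans (msizeM_leq _ _))// -subn1 leq_subLR add1n.
  exact: leq_add f2 IHi.
rewrite -{1}[p]coefK poly_def linear_sum /=.
rewrite (leq_trans (msize_sum _ _ _))//; apply/bigmax_leqP => i _.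
rewrite linearZ /= rmorphXn /= horner_algX mulr_algl (leq_trans (msizeZ_le _ _))//.
exact: leq_trans (fX i) (ltn_ord i).
Qed.

Let msize_affine (i : 'I_2) c : (msize (c%:MP * 'X_i - 1 : {mpoly R[2]}) <= 2)%N.
Proof.
apply: msizeD_leq; last by rewrite msizeN msize1.
by rewrite mul_mpolyC (leq_trans (msizeZ_le _ _))// msizeX mdeg1.
Qed.

Lemma msize_in_x (p : {poly R}) : (msize (in_x p) <= size p)%N.
Proof.
by apply: msize_horner_alg; rewrite -[2%:R]mpolyC_nat; exact: msize_affine.
Qed.

Lemma msize_in_y (p : {poly R}) : (msize (in_y p) <= size p)%N.
Proof.
by apply: msize_horner_alg; rewrite -[2%:R]mpolyC_nat; exact: msize_affine.
Qed.

Let size_jacobi (a b : R) n : -1 < a -> -1 < b -> size (jacobi b a n) = n.+1.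
Proof.
move=> a1 b1; rewrite -(size_sjacobi n a1 b1) -jacobi_to_sym//.
by rewrite (size_comp_poly2 _ (size_to_sym R)).
Qed.

Lemma msize_Ppoly n : (msize (Ppoly alpha beta gamma n) <= n.+1)%N.
Proof.
case: n => [|n]; first by rewrite msize1.
apply: msizeD_leq; first apply: msizeD_leq.
- by rewrite (leq_trans (msize_in_x _))// size_jacobi.
- by rewrite (leq_trans (msize_in_y _))// size_jacobi.
- by rewrite msizeN msizeC (leq_trans (leq_b1 _)).
Qed.

Lemma msize_Qpoly m : (msize (Qpoly sigma alpha beta gamma m.+1) <= m.+2)%N.
Proof.
have le2 (i : 'I_2) : (msize (1 - 'X_i : {mpoly R[2]}) <= 2)%N.
  by apply: msizeD_leq; rewrite ?msize1// msizeN msizeX mdeg1.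
have leM (i : 'I_2) f : (msize f <= m.+1)%N -> (msize ((1 - 'X_i) * f) <= m.+2)%N.
  move=> fm; rewrite (leq_trans (msizeM_leq _ _))// -subn1 leq_subLR add1n.
  exact: leq_add (le2 i) fm.
apply: msizeD_leq; rewrite ?msizeN (leq_trans (msizeZ_le _ _))//; apply: leM.
- by rewrite (leq_trans (msize_in_x _))// size_jacobi.
- by rewrite (leq_trans (msize_in_y _))// size_jacobi.
Qed.

Lemma Ppoly_Hspace n :
  Hspace sigma alpha beta gamma n (wclass (Ppoly alpha beta gamma n)).
Proof.
split; first by exists (Ppoly alpha beta gamma n) => //; exact: msize_Ppoly.
move=> q qn; have [G Gn qG] := beval_restrict_x qn.
have [G' Gn' qG'] := beval_restrict_y qn.
rewrite wip_class (bip_bmean (beval_Ppoly_x n) (beval_Ppoly_y n) qG qG').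
by rewrite !sjacobi_orthogonal// mulr0 addr0.
Qed.

Lemma Qpoly_Hspace m :
  Hspace sigma alpha beta gamma m.+1 (wclass (Qpoly sigma alpha beta gamma m.+1)).
Proof.
split.
  by exists (Qpoly sigma alpha beta gamma m.+1) => //; exact: msize_Qpoly.
move=> q qn; have [G Gn qG] := beval_restrict_x qn.
have [G' Gn' qG'] := beval_restrict_y qn.
rewrite wip_class (bip_bmean (beval_Qpoly_x m) (beval_Qpoly_y m) qG qG').
rewrite -(scalerAl (- sigma^-1)) linearZ /= !bmean_qrestr_mul// -qG -qG'.
by rewrite /GRing.scale /= mulNr mulrN mulVKf ?subrr// gt_eqF.
Qed.

End Wedge.

Theorem theorem2p7 (R : realType) (sigma alpha beta gamma : R)
    (halpha : -1 < alpha) (hbeta : -1 < beta) (hgamma : -1 < gamma)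
    (hsigma : 0 < sigma) :
  let P := fun n => wclass (Ppoly alpha beta gamma n) in
  let Q := fun n => wclass (Qpoly sigma alpha beta gamma n) in
  let ip := wip sigma alpha beta gamma in
  (forall n : nat, (1 <= n)%N ->
     [/\ P n \in Hspace sigma alpha beta gamma n,
         Q n \in Hspace sigma alpha beta gamma n,
         ip (P n) (Q n) =
           (beta - alpha) * poch (gamma + 1) n.+1
           / ((2 * n%:R + gamma + alpha + 1) * (2 * n%:R + gamma + beta + 1)
              * (n.-1)`!%:R)
       & beta = alpha -> ip (P n) (Q n) = 0]) /\
  (forall n : nat,
     ip (P n) (P n) = hnorm alpha gamma n + sigma * hnorm beta gamma n) /\
  (forall n : nat, (1 <= n)%N ->
     ip (Q n) (Q n) =
       poch (gamma + 1) 2 * poch (alpha + gamma + 2) n ^+ 2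
       / (poch (alpha + gamma + 2) 2 * poch (alpha + 1) n.-1 ^+ 2)
       * hnorm alpha (gamma + 2) n.-1
       + sigma^-1 *
         (poch (gamma + 1) 2 * poch (beta + gamma + 2) n ^+ 2
          / (poch (beta + gamma + 2) 2 * poch (beta + 1) n.-1 ^+ 2))
         * hnorm beta (gamma + 2) n.-1).
Proof.
move=> P Q ip; rewrite /ip /P /Q.
have s0 : sigma != 0 by rewrite gt_eqF.
have ipE := bip_bmean sigma halpha hbeta hgamma.
have Px := beval_Ppoly_x halpha hbeta hgamma.
have Py := beval_Ppoly_y halpha hbeta hgamma.
have Qx := beval_Qpoly_x sigma beta halpha hgamma.
have Qy := beval_Qpoly_y sigma alpha hbeta hgamma.
have PQ m : wip sigma alpha beta gamma (wclass (Ppoly alpha beta gamma m.+1))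
    (wclass (Qpoly sigma alpha beta gamma m.+1)) =
    (beta - alpha) * poch (gamma + 1) m.+2
    / ((2 * m.+1%:R + gamma + alpha + 1) * (2 * m.+1%:R + gamma + beta + 1)
       * m`!%:R).
  rewrite wip_class (ipE _ _ _ _ _ _ (Px m.+1) (Py m.+1) (Qx m) (Qy m)).
  rewrite -(scalerAr (- sigma^-1)) linearZ /= !bmean_sjacobi_qrestr// [poch _ m.+2]pochS.
  have m0 : 0 <= m%:R :> R by [].
  have na : 2 * m.+1%:R + gamma + alpha + 1 != 0 by rewrite gt_eqF// -natr1; lra.
  have nb : 2 * m.+1%:R + gamma + beta + 1 != 0 by rewrite gt_eqF// -natr1; lra.
  have nf := fact_neq0 R m.
  rewrite /GRing.scale /=; move: (m.+1%:R) na nb => M na nb; field.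
  by rewrite s0 na nb nf.
split; last split.
- case=> // m _; split.
  + by rewrite inE; exact: Ppoly_Hspace.
  + by rewrite inE; exact: Qpoly_Hspace.
  + exact: PQ.
  + by move=> ba; rewrite PQ ba subrr !mul0r.
- move=> n; rewrite wip_class !hnorm_bmean// !expr2.
  exact: (ipE _ _ _ _ _ _ (Px n) (Py n) (Px n) (Py n)).
- case=> // m _; rewrite wip_class (ipE _ _ _ _ _ _ (Qx m) (Qy m) (Qx m) (Qy m)).
  rewrite !hnorm_bmean//; try lra.
  rewrite -(scalerAl (- sigma^-1)) -(scalerAr (- sigma^-1)).
  rewrite !linearZ /= -!expr2 !bmean_qrestr_sq//.
  congr (_ + _); rewrite /GRing.scale /= !mulNr !mulrN opprK mulVKf//.
  by rewrite mulrA.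
Qed.
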